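(* Let $\{G=(V,E),w,T\}$ be an instance of \texttt{k-terminal cut} with $T=\{t_1,\ldots,t_k\}$ that is $(k-1)$-stable, and let $(S_1^*,\ldots,S_k^* )$ be its (unique) optimal partition. For each $i\in\{1,\ldots,k\}$, let $Q_i$ be the source set of the $t_i$-isolating cut. Then $Q_i=S_i^*$ for all $i\in\{1,\ldots,k\}$.
   Context: An instance $\{G=(V,E),w,T\}$ of \texttt{k-terminal cut} consists of an undirected graph $G=(V,E)$, a weight function $w:E\to\mathbb{R}^+$ (positive reals), and a set $T=\{t_1,\ldots,t_k\}\subseteq V$ of $k$ distinct terminals. The problem is to remove a minimum-weight set of edges so that no path connects any two terminals. Equivalently, a feasible solution is given by source sets: a partition $(S_1,\ldots,S_k)$ of $V$ with $t_i\in S_i$, whose cut consists of all edges with endpoints in different parts; the optimal cut $E_{\text{OPT}}$ has optimal source sets $(S_1^*,\ldots,S_k^* )$. For $\gamma>1$, a $\gamma$-perturbation of $(G,w)$ is the same graph with weights $w'$ satisfying $w(e)\le w'(e)\le\gamma w(e)$ for all $e\in E$. The instance is $\gamma$-stable if there is an optimal solution $E_{\text{OPT}}$ which is the unique optimal \texttt{k-terminal cut} solution for every $\gamma$-perturbation (in particular the optimal solution is unique). The $t_i$-isolating cut is a minimum $(s,t)$-cut separating $s=t_i$ from all other terminals (with $T\setminus\{t_i\}$ merged into a single sink $t$); its source set $Q_i$ is the set of vertices remaining connected to $t_i$ after removing the cut edges. *)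

(* Defs.v *)
From mathcomp Require Import all_boot all_order all_algebra.

Set Implicit Arguments.
Unset Strict Implicit.
Unset Printing Implicit Defensive.

Import Order.TTheory GRing.Theory Num.Theory.
Local Open Scope ring_scope.

(* A finite simple undirected graph on V is given by its edge set E, each edge
   being an unordered pair of distinct vertices. *)
Definition simple_graph (V : finType) (E : {set {set V}}) : Prop :=
  forall e, e \in E -> #|e| = 2%N.

Definition adjacent (V : finType) (E : {set {set V}}) : rel V :=
  fun x y => [set x; y] \in E.

Definition connected_in (V : finType) (E : {set {set V}}) (x y : V) : bool :=
  connect (adjacent E) x y.

Section Cuts.

Variables (R : realFieldType) (V : finType) (k : nat).

(* Weights are total functions on {set V}; only the values on E matter. *)
Implicit Types (E F : {set {set V}}) (w : {set V} -> R) (t : 'I_k -> V).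
Implicit Types (S : {ffun 'I_k -> {set V}}).

Definition weight w F : R := \sum_(e in F) w e.

Definition kterminal_cut E t F : Prop :=
  F \subset E /\
  forall i j, i != j -> ~~ connected_in (E :\: F) (t i) (t j).

Definition optimal_cut E w t F : Prop :=
  kterminal_cut E t F /\
  forall F', kterminal_cut E t F' -> weight w F <= weight w F'.

Definition perturbation E (gamma : R) w w' : Prop :=
  forall e, e \in E -> w e <= w' e <= gamma * w e.

Definition stable E w t (gamma : R) : Prop :=
  exists F, optimal_cut E w t F /\
    forall w', perturbation E gamma w w' -> unique (optimal_cut E w' t) F.

Definition source_partition t S : Prop :=
  [/\ forall i, t i \in S i,
      forall i j, i != j -> [disjoint S i & S j] &
      \bigcup_i S i = [set: V]].

Definition cut_of E S : {set {set V}} :=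
  [set e in E | [exists i, exists j,
     [&& i != j, e :&: S i != set0 & e :&: S j != set0]]].

Definition optimal_partition E w t S : Prop :=
  source_partition t S /\ optimal_cut E w t (cut_of E S).

(* Merging the other terminals into one sink amounts to requiring that each of
   them be disconnected from t i. *)
Definition separates E t (i : 'I_k) F : Prop :=
  F \subset E /\
  forall j, j != i -> ~~ connected_in (E :\: F) (t i) (t j).

Definition isolating_cut E w t (i : 'I_k) F : Prop :=
  separates E t i F /\
  forall F', separates E t i F' -> weight w F <= weight w F'.

Definition source_set E t (i : 'I_k) F : {set V} :=
  [set x | connected_in (E :\: F) (t i) x].

End Cuts.

(* Main.v *)
Require Import Defs.
From mathcomp Require Import all_boot all_order all_algebra.
From mathcomp Require Import zify lra.

Set Implicit Arguments.
Unset Strict Implicit.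
Unset Printing Implicit Defensive.

Import Order.TTheory GRing.Theory Num.Theory.
Local Open Scope ring_scope.

(** Let [C] be the optimal cut. For each [j] the union [A_j] of the isolating
cuts [F_i], [i != j], is a k-terminal cut, so stability gives
[(k - 1) w(C - A_j) < w(A_j - C)] unless [A_j = C]. Summed over [j], these
inequalities contradict [sum_i w(F_i) <= sum_i w(boundary of S_i) = 2 w(C)]
unless every [A_j] equals [C]; hence every [F_i] is contained in [C]. Since the
optimal partition is unique, each [S_i] is the component of [t_i] in [E - C],
and it is therefore contained in the component [Q_i] of [t_i] in [E - F_i];
as [Q_i] contains no other terminal, it meets no other [S_j]. *)

(** * Reachability through a set of edges *)

Lemma connected_in_sym (V : finType) (G : {set {set V}}) (x y : V) :
  connected_in G x y = connected_in G y x.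
Proof. by apply: sym_connect_sym => u v; rewrite /adjacent setUC. Qed.

Lemma connected_in_mono (V : finType) (G G' : {set {set V}}) (x y : V) :
  G \subset G' -> connected_in G x y -> connected_in G' x y.
Proof.
move=> sGG'; apply: connect_sub => u v uv; apply: connect1.
exact: (subsetP sGG').
Qed.

Lemma connected_in_closed (V : finType) (G : {set {set V}}) (A : {set V}) x y :
  (forall u v, [set u; v] \in G -> u \in A -> v \in A) ->
  connected_in G x y -> x \in A -> y \in A.
Proof.
move=> clA xy xA; have clGA : closed (adjacent G) (mem A).
  by apply: intro_closed => //; exact: connected_in_sym.
by have := closed_connect clGA xy; rewrite xA => <-.
Qed.

(** * Weights of edge sets *)

Section Weight.

Variables (R : realFieldType) (T : finType) (w : {set T} -> R).
Implicit Types A B : {set {set T}}.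

Lemma weightID A B : weight w A = weight w (A :&: B) + weight w (A :\: B).
Proof. exact: big_setID. Qed.

Lemma weight_subset A B :
  (forall e, e \in B -> 0 <= w e) -> A \subset B -> weight w A <= weight w B.
Proof.
move=> w0 sAB; rewrite (weightID B A) (setIidPr sAB) lerDl.
by apply: sumr_ge0 => e /setDP[/w0].
Qed.

(** Double counting: it turns sums over terminals into sums over edges, to be compared edge by
    edge. *)
Lemma sum_weight (I : finType) A (F : I -> {set {set T}}) :
  (forall i, F i \subset A) ->
  \sum_i weight w (F i) = \sum_(e in A) w e *+ #|[set i | e \in F i]|.
Proof.
move=> sFA; rewrite /weight (exchange_big_dep (mem A)) /=; last first.
  by move=> i e _; exact: (subsetP (sFA i)).
by apply: eq_bigr => e _; rewrite sumr_const -[in RHS]cardsE; congr (_ *+ _);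
  apply: eq_card => i; rewrite !inE.
Qed.

End Weight.

(** Raising the weights on [C :\: A] by the factor [gamma] is a perturbation, under which [C] is
    still the unique optimum and so beats [A]; the common part [C :&: A] cancels. *)
Lemma stable_gap (R : realFieldType) (V : finType) (k : nat)
    (E C A : {set {set V}}) (w : {set V} -> R) (t : 'I_k -> V) (gamma : R) :
  (forall e, e \in E -> 0 <= w e) -> 1 <= gamma -> stable E w t gamma ->
  optimal_cut E w t C -> kterminal_cut E t A -> A != C ->
  gamma * weight w (C :\: A) < weight w (A :\: C).
Proof.
move=> w0 g1 [C0 [_ uniqC0]] optC cutA neAC.
have wle e : e \in E -> w e <= gamma * w e by move=> /w0 we; rewrite ler_peMl.
(* As [1 <= gamma], [w] perturbs itself, which identifies the cut given by stability with [C]. *)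
have pert_w : perturbation E gamma w w by move=> e eE; rewrite lexx wle.
have [_ /(_ C optC) eqC] := uniqC0 w pert_w; subst C0.
pose w' e := if e \in C :\: A then gamma * w e else w e.
have [[_ minC] uC] : unique (optimal_cut E w' t) C.
  by apply: uniqC0 => e eE; rewrite /w'; case: ifP; rewrite ?lexx wle.
have ltCA : weight w' C < weight w' A.
  rewrite lt_neqAle minC // andbT; apply: contraNneq neAC => eqw.
  by rewrite (uC A) //; split=> // F' /minC; rewrite eqw.
have w'E (B : {set {set V}}) : [disjoint B & C :\: A] -> weight w' B = weight w B.
  move=> dB; apply: eq_bigr => e eB; rewrite /w' ifN //.
  by rewrite (disjointFr dB).
have w'D : weight w' (C :\: A) = gamma * weight w (C :\: A).
  by rewrite /weight mulr_sumr; apply: eq_bigr => e; rewrite /w' => ->.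
rewrite (weightID w' C A) (weightID w' A C) w'D setIC !w'E ?ltrD2l // in ltCA.
- by rewrite -setI_eq0; apply/eqP/setP => e; rewrite !inE; do 2!case: (_ \in _).
- by rewrite -setI_eq0; apply/eqP/setP => e; rewrite !inE; do 2!case: (_ \in _).
Qed.

(** The count [a] is [#|T|], [1] or [0] as [X] is empty, a singleton or larger. Later [X] indexes
    the isolating cuts through an edge [e], and [a] counts the unions that miss [e]. *)
Lemma card_subset1 (T : finType) (X : {set T}) (a := #|[set j | X \subset [set j]]|) :
  (1 < #|T|)%N -> (2 <= #|X| + a)%N /\ (#|T| <= a + #|T|.-1 * #|X|)%N.
Proof.
rewrite /a => {a} T1; case: (posnP #|X|) => [/cards0_eq -> | X0].
  have -> : [set j : T | set0 \subset [set j]] = setT.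
    by apply/setP => j; rewrite !inE sub0set.
  by rewrite cards0 cardsT; lia.
case: (ltngtP #|X| 1) => [| X1 |]; [by lia | by nia |].
move/eqP/cards1P => [x ->].
suff : (0 < #|[set j | [set x] \subset [set j]]|)%N by rewrite cards1; lia.
by apply/card_gt0P; exists x; rewrite inE.
Qed.

Lemma exists_other_ord (k : nat) (i : 'I_k) : (1 < k)%N -> exists j, i != j.
Proof.
move=> k1; have /card_gt1P[a [b [_ _ ab]]] : (1 < #|'I_k|)%N by rewrite card_ord.
by have [->|] := eqVneq i a; [exists b | exists a].
Qed.

(** * Partitions and the cuts they induce *)

Section Partition.

Variables (V : finType) (k : nat) (E : {set {set V}}) (t : 'I_k -> V).
Implicit Types S : {ffun 'I_k -> {set V}}.

Lemma source_partition_inj S x i j :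
  source_partition t S -> x \in S i -> x \in S j -> i = j.
Proof.
move=> [_ dS _] xi xj; apply/eqP; apply: contraLR xj => /dS dij.
by rewrite (disjointFr dij).
Qed.

Lemma source_partition_cover S x :
  source_partition t S -> exists i, x \in S i.
Proof.
by move=> [_ _ cS]; have := in_setT x; rewrite -cS => /bigcupP[i _]; exists i.
Qed.

Lemma mem_cut_of S x y i j :
  [set x; y] \in E -> x \in S i -> y \in S j -> i != j ->
  [set x; y] \in cut_of E S.
Proof.
move=> eE xi yj ij; rewrite inE eE; apply/existsP; exists i.
apply/existsP; exists j; rewrite ij /=; apply/andP; split; apply/set0Pn.
- by exists x; rewrite !inE eqxx.
- by exists y; rewrite !inE eqxx orbT.
Qed.

Lemma cut_of_subset S : cut_of E S \subset E.
Proof. by apply/subsetP => e; rewrite inE => /andP[]. Qed.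

Definition part_boundary S i : {set {set V}} :=
  [set e in cut_of E S | e :&: S i != set0].

(** A path leaving [S i] must cross the boundary, and [S i] contains no terminal but [t i]. *)
Lemma part_boundary_separates S i :
  source_partition t S -> separates E t i (part_boundary S i).
Proof.
move=> pS; split=> [|j ji].
  by apply: subset_trans (cut_of_subset S); apply/subsetP => e /setIdP[].
have [tS _ _] := pS.
apply: contraNN ji => tij; suff tj : t j \in S i.
  by apply/eqP; exact: source_partition_inj pS (tS j) tj.
apply: (connected_in_closed _ tij) => // u v.
rewrite in_setD => /andP[nuv uvE] ui; have [l vl] := source_partition_cover v pS.
have [->//|il] := eqVneq i l; rewrite inE (mem_cut_of uvE ui vl il) /= in nuv.
by case/set0Pn: nuv; exists u; rewrite !inE eqxx.
Qed.

Lemma cut_of_kterminal S : source_partition t S -> kterminal_cut E t (cut_of E S).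
Proof.
move=> pS; split=> [|i j ij]; first exact: cut_of_subset.
have [_ /(_ j)] := part_boundary_separates i pS; rewrite eq_sym ij => /(_ isT).
apply: contraNN; apply: connected_in_mono; apply: setDS.
by apply/subsetP => e /setIdP[].
Qed.

(** Choosing a vertex of [e] in each part met is injective, the parts being disjoint. For an edge of
    a simple graph the bound is 2. *)
Lemma card_parts_meeting S (e : {set V}) :
  source_partition t S -> (#|[set i | e :&: S i != set0]| <= #|e|)%N.
Proof.
move=> pS; have meetP i (eS : e :&: S i != set0) : {x | x \in e :&: S i}.
  by apply: sigW; apply/set0Pn.
have [->|] := set_0Vmem e.
  by rewrite cards0 leqn0 cards_eq0; apply/eqP/setP => i; rewrite !inE set0I eqxx.
move=> [x0 _]; pose f i := odflt x0 [pick x in e :&: S i].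
have fP i : e :&: S i != set0 -> f i \in e :&: S i.
  by rewrite /f; case: pickP => //= none /set0Pn[x]; rewrite none.
rewrite -(@card_in_imset _ _ f).
  apply: subset_leq_card; apply/subsetP => _ /imsetP[i + ->].
  by rewrite inE => /fP /setIP[].
move=> i j; rewrite !inE => /fP/setIP[_ fi] /fP/setIP[_ fj] eqf.
by apply: (source_partition_inj pS fi); rewrite eqf.
Qed.

End Partition.

(** * Isolating cuts and the optimal partition *)

(** A component inside [S i] that misses [t i] contains no terminal, so giving it to another part
    keeps a valid partition and adds no cut edge: a second optimal partition. *)
Lemma unique_partition_component (R : realFieldType) (V : finType) (k : nat)
    (E : {set {set V}}) (w : {set V} -> R) (t : 'I_k -> V)
    (S : {ffun 'I_k -> {set V}}) (i : 'I_k) (x : V) :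
  (1 < k)%N -> simple_graph E -> (forall e, e \in E -> 0 <= w e) ->
  unique (optimal_partition E w t) S -> x \in S i ->
  connected_in (E :\: cut_of E S) (t i) x.
Proof.
move=> k1 simpleE w0 [[pS [_ minS]] uS] xi; apply/negPn/negP => ntx.
have [j ij] := exists_other_ord i k1.
pose G := E :\: cut_of E S; pose K := [set y | connected_in G x y].
have clK u v : [set u; v] \in G -> u \in K -> v \in K.
  by move=> uv; rewrite !inE => xu; apply: connect_trans xu (connect1 uv).
have sKS y : y \in K -> y \in S i.
  rewrite inE => xy; apply: (connected_in_closed _ xy xi) => u v.
  rewrite in_setD => /andP[nuv uvE] ui.
  have [l vl] := source_partition_cover v pS.
  by have [->//|il] := eqVneq i l; rewrite (mem_cut_of uvE ui vl il) in nuv.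
(* Otherwise the component [K] of [x] could be moved to another part. *)
pose S' := [ffun l => if l == j then S j :|: K else S l :\: K].
have S'P l y : (y \in S' l) = if y \in K then l == j else y \in S l.
  rewrite ffunE; case: eqP => [->|_]; rewrite !(in_setU, in_setD);
  by case: (y \in K); rewrite ?orbT ?orbF.
have pS' : source_partition t S'.
  have [tS dS cS] := pS; split.
  - move=> l; rewrite S'P ifN //; apply/negP => tK.
    have il := source_partition_inj pS (tS l) (sKS _ tK).
    by move: tK; rewrite inE connected_in_sym il (negPf ntx).
  - move=> a b ab; rewrite disjoint_subset; apply/subsetP => y.
    rewrite inE !S'P; case: ifP => _; first by move/eqP <-; rewrite eq_sym.
    by move=> ya; rewrite (disjointFr (dS _ _ ab)).
  - apply/setP => y; rewrite in_setT; apply/bigcupP.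
    have [l yl] := source_partition_cover y pS.
    by case yK: (y \in K); [exists j | exists l]; rewrite // S'P yK.
(* The ends of an edge outside the cut lie both in [K] or both outside, so the move cannot separate
   them. *)
have subC : cut_of E S' \subset cut_of E S.
  apply/subsetP => e eC; have eE := subsetP (cut_of_subset _ _) _ eC.
  apply/negPn/negP => neC; move: eC; rewrite inE eE /=.
  case/existsP=> a /existsP[b /and3P[ab /set0Pn[u /setIP[ue ua]]]].
  move=> /set0Pn[v /setIP[ve vb]].
  have uv : u != v.
    apply: contraNneq ab => eq_uv; apply/eqP; rewrite eq_uv in ua.
    exact: (source_partition_inj pS' ua).
  have eE2 : e = [set u; v].
    apply/esym/eqP; rewrite eqEcard simpleE // cards2 uv andbT.
    by apply/subsetP => y; rewrite !inE => /orP[] /eqP ->.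
  subst e.
  have eG : [set u; v] \in G by rewrite in_setD neC.
  have Kuv : (u \in K) = (v \in K).
    by apply/idP/idP; apply: clK; rewrite // setUC.
  move: ua vb; rewrite !S'P Kuv; case: ifP => _ ua vb.
    by rewrite (eqP ua) (eqP vb) eqxx in ab.
  by rewrite (mem_cut_of eE ua vb ab) in neC.
have xS' : x \in S' i.
  rewrite -(uS S') //; split=> //; split; first exact: cut_of_kterminal.
  move=> F' /minS; apply: le_trans; apply: weight_subset => // e.
  by move/(subsetP (cut_of_subset _ _))/w0.
by move: xS'; rewrite S'P inE /connected_in connect0 (negPf ij).
Qed.

(** All sums over terminals become sums over edges, whose coefficients are compared on [C] and on
    [E :\: C] separately. *)
Lemma isolating_cut_subset (R : realFieldType) (V : finType) (k : nat)
    (E : {set {set V}}) (w : {set V} -> R) (t : 'I_k -> V)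
    (S : {ffun 'I_k -> {set V}}) (F : 'I_k -> {set {set V}}) (i : 'I_k) :
  (1 < k)%N -> simple_graph E -> (forall e, e \in E -> 0 <= w e) ->
  stable E w t (k%:R - 1) -> optimal_partition E w t S ->
  (forall i, isolating_cut E w t i (F i)) ->
  F i \subset cut_of E S.
Proof.
move=> k1 simpleE w0 stE [pS optC] isoF; set C := cut_of E S in optC *.
have sCE : C \subset E := cut_of_subset _ _.
have sFE l : F l \subset E by have [[]] := isoF l.
pose A j := \bigcup_(l | l != j) F l.
(* Of two distinct terminals at least one, say [t l], has [l != j]; then [F l] lies in [A j] and
   separates them. *)
have cutA j : kterminal_cut E t (A j).
  have sFA l : l != j -> E :\: A j \subset E :\: F l.
    by move=> lj; apply: setDS; apply: (bigcup_sup l).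
  split=> [|a b ab]; first by apply/bigcupsP => l _.
  have [aj|aj] := eqVneq a j.
    rewrite connected_in_sym; have [[_ sep _]] := isoF b.
    by apply: contraNN (sep a ab); apply/connected_in_mono/sFA; rewrite eq_sym -aj.
  have [[_ sep _]] := isoF a; rewrite eq_sym in ab.
  by apply: contraNN (sep b ab); apply/connected_in_mono/sFA.
suff AC j : A j = C.
  have [j ij] := exists_other_ord i k1.
  by rewrite -(AC j); apply: (bigcup_sup i).
apply/eqP/negPn/negP => neAC.
have kE : k%:R - 1 = k.-1%:R :> R.
  by rewrite -[in LHS](ltn_predK k1) -natr1 addrK.
have g1 : 1 <= k%:R - 1 :> R by rewrite kE ler1n; lia.
(* Strict at the index [j] with [A j != C]; where [A l = C], both sides vanish. *)
have gap : \sum_l (k%:R - 1) * weight w (C :\: A l) < \sum_l weight w (A l :\: C).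
  have gapl l : A l != C -> (k%:R - 1) * weight w (C :\: A l) < weight w (A l :\: C).
    exact: stable_gap (cutA l).
  rewrite (bigD1 j) //= [ltRHS](bigD1 j) //=; apply: ltr_leD; first exact: gapl.
  apply: ler_sum => l _; have [->|/gapl/ltW//] := eqVneq (A l) C.
  by rewrite setDv /weight big_set0 mulr0.
(* Each [F l] weighs at most the boundary of [S l], and an edge of [C] lies in at most two
   boundaries. *)
have sumF : \sum_l weight w (F l) <= \sum_(e in C) w e *+ 2.
  apply: (@le_trans _ _ (\sum_l weight w (part_boundary E S l))).
    by apply: ler_sum => l _; have [_] := isoF l; apply; apply: part_boundary_separates.
  rewrite (sum_weight w (A := C)); last by move=> l; apply/subsetP => e /setIdP[].
  apply: ler_sum => e eC; have eE := subsetP sCE e eC.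
  apply: ler_wpMn2l; first exact: w0.
  rewrite -(simpleE e eE); apply: leq_trans (card_parts_meeting e pS).
  by apply: subset_leq_card; apply/subsetP => l; rewrite !inE => /andP[].
(* An edge [e] avoids [A l] exactly when no isolating cut other than [F l] contains it, which is the
   count of [card_subset1]. *)
pose n e := #|[set l | e \in F l]|; pose a e := #|[set l | e \notin A l]|.
have [n_ge a_ge] : (forall e, 2 <= n e + a e)%N /\
    (forall e, k <= a e + k.-1 * n e)%N.
  have na e : (2 <= n e + a e)%N /\ (k <= a e + k.-1 * n e)%N.
    have := @card_subset1 _ [set l | e \in F l]; rewrite card_ord => /(_ k1).
    have -> : [set j : 'I_k | [set l | e \in F l] \subset [set j]] =
        [set l | e \notin A l] => //.
    apply/setP => l; rewrite !inE; apply/subsetP/negP => [sub /bigcupP[m ml em]|nA m].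
      by have := sub m; rewrite !inE em (negPf ml) => /(_ isT).
    rewrite !inE => em; apply/negPn/negP => ml; apply: nA.
    by apply/bigcupP; exists m.
  by split=> e; case: (na e).
have Ca e : e \in C -> #|[set l | e \in C :\: A l]| = a e.
  by move=> eC; apply: eq_card => l; rewrite 2!in_set in_setD eC andbT.
have Da e : e \in E :\: C -> (#|[set l | e \in A l :\: C]| + a e)%N = k.
  case/setDP => _ eC; rewrite -[RHS]card_ord -(cardsC [set l | e \in A l]).
  congr addn; apply: eq_card => l; last by rewrite in_setC !in_set.
  by rewrite 2!in_set in_setD eC.
rewrite -mulr_sumr (sum_weight w (A := C) (F := fun l => C :\: A l)) in gap;
  last by move=> l; exact: subsetDl.
rewrite (sum_weight w (A := E :\: C)) in gap; last first.
  by move=> l; apply: setSD; have [] := cutA l.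
rewrite (sum_weight w (A := E)) // (big_setID C) /= (setIidPr sCE) in sumF.
(* Edgewise, this is [2 <= n e + a e]. *)
have inC : \sum_(e in C) w e *+ 2 <=
    \sum_(e in C) w e *+ n e + \sum_(e in C) w e *+ #|[set l | e \in C :\: A l]|.
  rewrite -big_split; apply: ler_sum => e eC /=; rewrite -mulrnDr Ca //.
  by apply: ler_wpMn2l => //; apply/w0/(subsetP sCE).
(* Outside [C], the coefficient on the left is [k - a e], at most [k.-1 * n e]. *)
have outC : \sum_(e in E :\: C) w e *+ #|[set l | e \in A l :\: C]| <=
    (k%:R - 1) * \sum_(e in E :\: C) w e *+ n e.
  rewrite mulr_sumr; apply: ler_sum => e eD.
  rewrite kE mulr_natl -mulrnA; apply: ler_wpMn2l; first by apply: w0; case/setDP: eD.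
  by have := Da e eD; have := a_ge e; lia.
(* By [sumF] and [inC], the total weight of the isolating cuts outside [C] is at most the sum over
   [C] with coefficients [a e]; with [outC] this contradicts [gap]. *)
move: gap; apply/negP; rewrite -leNgt; apply: le_trans outC _.
apply: ler_wpM2l; first by apply: le_trans g1.
by move: sumF inC; lra.
Qed.

Theorem theorem1 (R : realFieldType) (V : finType) (k : nat)
    (E : {set {set V}}) (w : {set V} -> R) (t : 'I_k -> V)
    (Sopt : {ffun 'I_k -> {set V}}) (F : 'I_k -> {set {set V}})
    (k_ge2 : (2 <= k)%N)
    (E_simple : simple_graph E)
    (w_pos : forall e, e \in E -> 0 < w e)
    (t_inj : injective t)
    (E_stable : stable E w t (k%:R - 1))
    (Sopt_unique : unique (optimal_partition E w t) Sopt)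
    (F_isolating : forall i, isolating_cut E w t i (F i)) :
  forall i, source_set E t i (F i) = Sopt i.
Proof.
move=> i; have w0 e : e \in E -> 0 <= w e by move/w_pos/ltW.
have [optS _] := Sopt_unique; have [pS _] := optS.
have sFC := isolating_cut_subset i k_ge2 E_simple w0 E_stable optS F_isolating.
(* For [l = i] this is one inclusion; for [l != i], a vertex of [Sopt l] reached from [t i] would
   connect [t i] to [t l], which [F i] forbids. *)
have conn l x : x \in Sopt l -> connected_in (E :\: F i) (t l) x.
  move=> xl; apply: (connected_in_mono (G := E :\: cut_of E Sopt)); first exact: setDS.
  exact: unique_partition_component Sopt_unique xl.
apply/setP => x; rewrite inE; apply/idP/idP => [tx|]; last exact: conn.
have [l xl] := source_partition_cover x pS.
have [<-//|li] := eqVneq l i; have [[_ sep] _] := F_isolating i.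
case/negP: (sep l li); apply: connect_trans tx _.
by rewrite -/(connected_in _ _ _) connected_in_sym conn.
Qed.
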